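(* Let $\mathcal S=(\mathcal U,\tilde\varphi,(\iota^{(i)})_{i\ge1})$ be a spreadability system for a $\mathcal B$-valued noncommutative probability space $(\mathcal A,\varphi)$, with partitioned cumulants $K_\pi$. For any $n\in\mathbb N$, $\pi\in\mathcal{OP}_n$ and $X_1,\dots,X_n\in\mathcal A$, $$K_\pi(X_1,\dots,X_n)=\sum_{\sigma\in\mathcal{OP}_n,\ \sigma\le\pi}\varphi_\sigma(X_1,\dots,X_n)\,\widetilde\mu(\sigma,\pi),$$ $$\varphi_\pi(X_1,\dots,X_n)=\sum_{\sigma\in\mathcal{OP}_n,\ \sigma\le\pi}K_\sigma(X_1,\dots,X_n)\,\widetilde\zeta(\sigma,\pi).$$
   Context: Ordered set partitions. $\mathbb N=\{1,2,\dots\}$, $[n]=\{1,\dots,n\}$. An ordered set partition of $[n]$ is a sequence $\pi=(P_1,\dots,P_p)$ of pairwise disjoint nonempty blocks with union $[n]$; $|\pi|=p$; $\mathcal{OP}_n$ is the set of them; $\pi(i)$ denotes the index $k$ with $i\in P_k$; $\bar\pi$ is the underlying set partition; set partitions are ordered by refinement. For $\pi=(P_1,\dots,P_p)$, $\sigma=(S_1,\dots,S_s)$ we write $\pi\le\sigma$ iff $\bar\pi\le\bar\sigma$ and, whenever $i<j$, $P_i\subseteq S_k$, $P_j\subseteq S_l$, one has $k\le l$. The quasi-meet is $\pi\curlywedge\sigma=(P_1\cap S_1,P_1\cap S_2,\dots,P_1\cap S_s,P_2\cap S_1,\dots,P_p\cap S_s)$ with empty sets removed. The ordered kernel $\kappa(i_1,\dots,i_n)\in\mathcal{OP}_n$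 has as blocks the level sets $\{k:i_k=v\}$ listed in increasing order of $v$. For $P\subseteq[n]$ nonempty, $\sigma\rfloor_P$ is the sequence $(P\cap S_1,\dots,P\cap S_s)$ with empty sets removed and $\#(\sigma\rfloor_P)$ its number of blocks. For $\sigma\le\pi$: $[\sigma:\pi]=\prod_{P\in\pi}\#(\sigma\rfloor_P)$, $[\sigma:\pi]!=\prod_{P\in\pi}\#(\sigma\rfloor_P)!$, $\widetilde\zeta(\sigma,\pi)=\frac1{[\sigma:\pi]!}$, $\widetilde\mu(\sigma,\pi)=\frac{(-1)^{|\sigma|-|\pi|}}{[\sigma:\pi]}$. Spreadability systems. Algebras are associative over $\mathbb C$. A $\mathcal B$-valued noncommutative probability space is an algebra $\mathcal A$ with a linear map $\varphi:\mathcal A\to\mathcal B$ into an algebra $\mathcal B$. A spreadability system for it is a triple $(\mathcal U,\tilde\varphi,(\iota^{(i)})_{i\ge1})$ with $\mathcal U$ an algebra, $\tilde\varphi:\mathcal U\to\mathcal B$ linear, $\iota^{(i)}:\mathcal A\to\mathcal U$ homomorphisms with $\varphi=\tilde\varphi\circ\iota^{(i)}$, such that, writing $X^{(i)}=\iota^{(i)}(X)$, $\tilde\varphi(X_1^{(i_1)}\cdots X_n^{(i_n)})=\tilde\varphi(X_1^{(h(i_1))}\cdots X_n^{(h(i_n))})$ for all $X_k\in\mathcal A$, $i_k\in\mathbb N$ and all $h:\{i_1,\dots,i_n\}\to\mathbb N$ with $i_p<i_q\Rightarrow h(i_p)<h(i_q)$. For $\pi\in\mathcal{OP}_n$, $\varphi_\pi(X_1,\dots,X_n):=\tilde\varphi(X_1^{(i_1)}\cdots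 X_n^{(i_n)})$ for any indices with $\kappa(i_1,\dots,i_n)=\pi$; one extends $\varphi_\pi(X_1^{(i_1)},\dots,X_n^{(i_n)}):=\varphi_{\pi\curlywedge\kappa(i_1,\dots,i_n)}(X_1,\dots,X_n)$ and $\varphi_\pi(M_1.X_1,\dots,M_n.X_n):=\sum_{i_1=1}^{M_1}\cdots\sum_{i_n=1}^{M_n}\varphi_\pi(X_1^{(i_1)},\dots,X_n^{(i_n)})$ for $M_k\in\mathbb N$. Cumulants. For $\pi\in\mathcal{OP}_n$ with $p$ blocks, the function $(N_1,\dots,N_p)\mapsto\varphi_\pi(N_{\pi(1)}.X_1,\dots,N_{\pi(n)}.X_n)$ on $\mathbb N^p$ is a polynomial in $N_1,\dots,N_p$ with coefficients in $\mathcal B$; the partitioned cumulant $K_\pi(X_1,\dots,X_n)$ is by definition the coefficient of $N_1N_2\cdots N_p$ in it. *)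

(* Defs.v *)
From HB Require Import structures.
From mathcomp Require Import all_boot all_order all_algebra finmap.
From mathcomp Require classical_sets.

Set Implicit Arguments.
Unset Strict Implicit.
Unset Printing Implicit Defensive.

Import Order.TTheory GRing.Theory Num.Theory.

Local Open Scope ring_scope.

(* Associative, not necessarily unital, algebras over K (the algebraic
   hierarchy of the library only has unital rings and algebras).             *)
HB.mixin Record hasAssocMul (K : fieldType) A of GRing.Lmodule K A := {
  amul : A -> A -> A;
  amulA : associative amul;
  amulDl : forall x y z, amul (x + y) z = amul x z + amul y z;
  amulDr : forall x y z, amul x (y + z) = amul x y + amul x z;
  amulZl : forall (a : K) x y, amul (a *: x) y = a *: amul x y;
  amulZr : forall (a : K) x y, amul x (a *: y) = a *: amul x y
}.

#[short(type="assocAlgType")]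
HB.structure Definition AssocAlgebra (K : fieldType) :=
  { A of hasAssocMul K A & GRing.Lmodule K A }.

(* The product x_1 ... x_n of a nonempty sequence; the value 0 on the empty
   sequence is a placeholder.                                                *)
Definition aprod (K : fieldType) (A : assocAlgType K) (s : seq A) : A :=
  if s is x :: s' then foldl amul x s' else 0.

Section OrderedSetPartitions.

Variable n : nat.
Implicit Types (s t : seq {set 'I_n}) (P S : {set 'I_n}).

Definition is_osp s : bool :=
  [&& set0 \notin s,
      pairwise (fun P S => [disjoint P & S]) s
    & \bigcup_(P <- s) P == [set: 'I_n]].

Lemma in_bigcup_has s k : (k \in \bigcup_(P <- s) P) = has (fun P => k \in P) s.
Proof. by elim: s => [|P s IHs]; rewrite ?big_nil ?inE // big_cons inE IHs. Qed.

Lemma osp_size s : is_osp s -> (size s <= n)%N.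
Proof.
case/and3P=> s0 sd /eqP sT; rewrite -[X in (_ <= X)%N]card_ord -cardsT -sT.
elim: s s0 sd {sT} => [|P s IHs] //=; rewrite in_cons negb_or => /andP[P0 s0].
case/andP=> Ps sd; rewrite big_cons cardsU.
have -> : P :&: \bigcup_(S <- s) S = set0.
  apply/setP=> k; rewrite !inE in_bigcup_has; apply/negP=> /andP[kP /hasP[S Ss kS]].
  by move/allP/(_ _ Ss): Ps; rewrite disjoints_subset => /subsetP/(_ _ kP); rewrite inE kS.
rewrite cards0 subn0 -add1n leq_add ?IHs //.
by rewrite card_gt0 eq_sym.
Qed.

(* Since a partition of [n] has at most n blocks (osp_size), bounding the
   length is no restriction; it makes the type finite.                       *)
Record OP := Osp {
  osp_blocks :> n.-bseq {set 'I_n};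
  osp_blocksP : is_osp osp_blocks
}.

HB.instance Definition _ := [isSub for osp_blocks].
HB.instance Definition _ := [Finite of OP by <:].

Definition mk_osp s (sP : is_osp s) : OP :=
  @Osp (Bseq (osp_size sP)) sP.

Lemma osp_has (pi : OP) k : has (fun P => k \in P) pi.
Proof. by case/and3P: (osp_blocksP pi) => _ _ /eqP/setP/(_ k); rewrite in_bigcup_has inE. Qed.

Lemma osp_find (pi : OP) k : (find (fun P => k \in P) pi < size pi)%N.
Proof. by rewrite -has_find osp_has. Qed.

(* pi(k), counted from 0. *)
Definition block_index (pi : OP) (k : 'I_n) : 'I_(size pi) :=
  Ordinal (osp_find pi k).

Definition osp_le (pi sigma : OP) : bool :=
  all (fun P => has (fun S => P \subset S) sigma) pi &&
  [forall i : 'I_(size pi), forall j : 'I_(size pi),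
   forall k : 'I_(size sigma), forall l : 'I_(size sigma),
     [&& (i < j)%N, nth set0 pi i \subset nth set0 sigma k
       & nth set0 pi j \subset nth set0 sigma l] ==> (k <= l)%N].

Definition qmeet_seq s t : seq {set 'I_n} :=
  [seq Q <- [seq P :&: Q | P <- s, Q <- t] | Q != set0].

Lemma qmeet_osp (pi sigma : OP) : is_osp (qmeet_seq pi sigma).
Proof.
case/and3P: (osp_blocksP pi) => _ pid _; case/and3P: (osp_blocksP sigma) => _ sid _.
apply/and3P; split; first by rewrite mem_filter eqxx.
  apply: (subseq_pairwise (filter_subseq _ _)).
  elim: (bseqval pi) pid => [|P s IHs] //= /andP[Ps sd].
  rewrite pairwise_cat IHs // andbT; apply/andP; split.
    apply/allrelP => _ _ /mapP[S _ ->] /allpairsP[[P' S'] /= [P's _ ->]].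
    move/allP/(_ _ P's): Ps; rewrite -!setI_eq0 => /eqP PP'.
    by rewrite setIACA PP' set0I.
  rewrite pairwise_map; apply: sub_pairwise sid => S S' /=.
  by rewrite -!setI_eq0 setIACA => /eqP->; rewrite setI0.
apply/eqP/setP=> k; rewrite in_bigcup_has inE.
have /hasP[P Ppi kP] := osp_has pi k; have /hasP[S Ssi kS] := osp_has sigma k.
apply/hasP; exists (P :&: S); last by rewrite inE kP.
rewrite mem_filter allpairs_f // andbT; apply/set0Pn; exists k.
by rewrite inE kP.
Qed.

Definition qmeet (pi sigma : OP) : OP := mk_osp (qmeet_osp pi sigma).

Definition okernel_seq (i : 'I_n -> nat) : seq {set 'I_n} :=
  [seq [set k | i k == v] | v <- sort leq (undup (codom i))].

Lemma okernel_osp i : is_osp (okernel_seq i).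
Proof.
have memE v : (v \in sort leq (undup (codom i))) = (v \in codom i).
  by rewrite mem_sort mem_undup.
apply/and3P; split.
- apply/mapP=> -[v]; rewrite memE => /codomP[k ->] /setP/(_ k).
  by rewrite !inE eqxx.
- rewrite pairwise_map; have : uniq (sort leq (undup (codom i))).
    by rewrite sort_uniq undup_uniq.
  rewrite uniq_pairwise; apply: sub_pairwise => v w /= vw.
  rewrite -setI_eq0; apply/eqP/setP=> k; rewrite !inE.
  by apply/negP=> /andP[/eqP-> /eqP vw']; rewrite vw' eqxx in vw.
- apply/eqP/setP=> k; rewrite in_bigcup_has inE.
  apply/hasP; exists [set l | i l == i k]; last by rewrite inE.
  by apply: map_f; rewrite memE codom_f.
Qed.

Definition okernel (i : 'I_n -> nat) : OP := mk_osp (okernel_osp i).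

Definition restr (sigma : OP) (P : {set 'I_n}) : seq {set 'I_n} :=
  [seq Q <- [seq P :&: Q | Q <- (sigma : seq _)] | Q != set0].

Definition bracket (sigma pi : OP) : nat :=
  (\prod_(P <- (pi : seq _)) size (restr sigma P))%N.

Definition bracket_fact (sigma pi : OP) : nat :=
  (\prod_(P <- (pi : seq _)) (size (restr sigma P))`!)%N.

Definition zeta_tilde (K : fieldType) (sigma pi : OP) : K :=
  (bracket_fact sigma pi)%:R^-1.

Definition mu_tilde (K : fieldType) (sigma pi : OP) : K :=
  (-1) ^+ (size sigma - size pi) / (bracket sigma pi)%:R.

End OrderedSetPartitions.

(* The index set {1, 2, ...} of the embeddings is represented by the
   order-isomorphic nat: ss_iota i is the embedding numbered i + 1. The map h
   of the spreadability condition is only constrained on {i_1, ..., i_n}.    *)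
Record spreadability_system (K : fieldType) (A B : assocAlgType K)
    (phi : {linear A -> B}) := SpreadabilitySystem {
  ss_alg : assocAlgType K;
  ss_phi : {linear ss_alg -> B};
  ss_iota : nat -> {linear A -> ss_alg};
  ss_iotaM : forall i x y,
    ss_iota i (amul x y) = amul (ss_iota i x) (ss_iota i y);
  ss_iota_phi : forall i x, ss_phi (ss_iota i x) = phi x;
  ss_spread : forall n (X : 'I_n -> A) (i : 'I_n -> nat) (h : nat -> nat),
    (forall p q, (i p < i q)%N -> (h (i p) < h (i q))%N) ->
    ss_phi (aprod [seq ss_iota (i k) (X k) | k : 'I_n]) =
    ss_phi (aprod [seq ss_iota (h (i k)) (X k) | k : 'I_n])
}.

Section Cumulants.

Variables (K : fieldType) (A B : assocAlgType K) (phi : {linear A -> B}).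
Variables (S : spreadability_system phi) (n : nat).
Implicit Types (pi : OP n) (X : 'I_n -> A) (i : 'I_n -> nat).

Definition phi_indices i X : B :=
  ss_phi S (aprod [seq ss_iota S (i k) (X k) | k : 'I_n]).

(* The indices i_k = pi(k) have ordered kernel pi (okernel_block_index), and
   any other choice gives the same value (phi_partE).                        *)
Definition phi_part pi X : B := phi_indices (fun k => block_index pi k) X.

Definition phi_part_ind pi X i : B := phi_part (qmeet pi (okernel i)) X.

(* phi_pi(M_1.X_1, ..., M_n.X_n); 'I_(M k) represents {1, ..., M_k}. *)
Definition phi_part_dot pi (M : 'I_n -> nat) X : B :=
  \sum_(i : {dffun forall k : 'I_n, 'I_(M k)}) phi_part_ind pi X (fun k => i k).

(* A polynomial in p variables with coefficients in B is the finitely supported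
   family of its coefficients, indexed by exponents.                         *)
Definition poly_eval p (c : {fsfun {ffun 'I_p -> nat} -> B with 0})
    (N : 'I_p -> nat) : B :=
  \sum_(a <- finsupp c) (\prod_j (N j)%:R ^+ a j : K) *: c a.

Definition phi_polynomial pi X
    (c : {fsfun {ffun 'I_(size pi) -> nat} -> B with 0}) : Prop :=
  forall N : 'I_(size pi) -> nat, (forall j, (0 < N j)%N) ->
    phi_part_dot pi (fun k => N (block_index pi k)) X = poly_eval c N.

Arguments phi_polynomial pi X c : clear implicits.

(* The coefficient of N_1 ... N_p; xget picks it from the polynomial, and is
   0 only if there is no polynomial.                                         *)
Definition cumulant pi X : B :=
  classical_sets.xget 0
    (fun b => exists2 c, phi_polynomial pi X c & b = c [ffun=> 1%N]).

End Cumulants.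

Section WellDefined.

Variable n : nat.
Implicit Types (pi : OP n) (i : 'I_n -> nat).

Lemma mem_nth_osp pi k m : (m < size pi)%N ->
  (k \in nth set0 pi m) = (block_index pi k == m :> nat).
Proof.
move=> mp; apply/idP/eqP => [km|<-]; last first.
  exact: (nth_find set0 (osp_has pi k)).
case/and3P: (osp_blocksP pi) => _ /(pairwiseP set0) pid _ /=.
have kf := nth_find set0 (osp_has pi k); have fp := osp_find pi k.
have dis a b : (a < size pi)%N -> (b < size pi)%N -> (a < b)%N ->
  k \in nth set0 pi a -> k \in nth set0 pi b -> False.
  move=> ap bp ab ka kb; have := pid a b ap bp ab.
  by rewrite disjoints_subset => /subsetP/(_ _ ka); rewrite inE kb.
by case: (ltngtP (find (fun P : {set 'I_n} => k \in P) pi) m) => // /dis H; case: H.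
Qed.

Lemma block_index_surj pi (m : 'I_(size pi)) : exists k, block_index pi k = m.
Proof.
case/and3P: (osp_blocksP pi) => pi0 _ _.
have /set0Pn[k km] : nth set0 pi m != set0.
  by apply: contraNneq pi0 => <-; apply: mem_nth.
by exists k; apply/val_inj/eqP; rewrite /= -mem_nth_osp in km *.
Qed.

Lemma okernel_block_index pi : okernel (fun k => block_index pi k) = pi.
Proof.
apply/val_inj/val_inj; rewrite /= /okernel_seq.
have -> : sort leq (undup (codom (fun k => block_index pi k : nat)))
        = iota 0 (size pi).
  apply: (sorted_eq leq_trans anti_leq).
  - exact: (sort_sorted leq_total).
  - exact: iota_sorted.
  apply: uniq_perm; rewrite ?sort_uniq ?undup_uniq ?iota_uniq // => m.
  rewrite mem_sort mem_undup mem_iota add0n /=.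
  apply/codomP/idP => [[k ->]|mp]; first exact: osp_find.
  by have [k km] := block_index_surj (Ordinal mp); exists k; move/(congr1 val): km => /=.
apply: (@eq_from_nth _ set0); rewrite size_map size_iota // => m mp.
rewrite (nth_map 0%N) ?size_iota // nth_iota // add0n.
by apply/setP=> k; rewrite inE mem_nth_osp.
Qed.

Lemma block_index_okernel i k :
  nth 0%N (sort leq (undup (codom i))) (block_index (okernel i) k) = i k.
Proof.
have kf := nth_find set0 (osp_has (okernel i) k).
have fp := osp_find (okernel i) k.
move: kf; rewrite /= (nth_map 0%N) ?inE; last first.
  by move: fp; rewrite size_map.
by move/eqP=> ->.
Qed.

Lemma phi_partE (K : fieldType) (A B : assocAlgType K) (phi : {linear A -> B})
    (S : spreadability_system phi) (pi : OP n) (X : 'I_n -> A) i :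
  okernel i = pi -> phi_indices S i X = phi_part S pi X.
Proof.
move=> <-; rewrite /phi_part /phi_indices.
set v := sort leq (undup (codom i)).
rewrite [RHS](@ss_spread _ _ _ _ S _ _ _ (nth 0%N v)).
  by congr (ss_phi S (aprod _)); apply: eq_map => k; rewrite block_index_okernel.
move=> p q pq; apply: (sorted_ltn_nth ltn_trans) => //; last 1 first.
- by rewrite inE -(size_map (fun v => [set k | i k == v])); apply: osp_find.
- by rewrite ltn_sorted_uniq_leq sort_uniq undup_uniq (sort_sorted leq_total).
- by rewrite inE -(size_map (fun v => [set k | i k == v])); apply: osp_find.
Qed.

End WellDefined.

(* Main.v *)
Require Import Defs.
From mathcomp Require Import all_boot all_order all_algebra finmap.
From mathcomp Require classical_sets.
From mathcomp Require Import zify ring.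
From mathcomp Require Import reals complex.

(** The sum defining phi_pi(N_{pi(1)}.X_1, ..., N_{pi(n)}.X_n) runs over index
   families i with i_k < N_{pi(k)}; grouping them by the quasi-meet
   sigma of pi with kappa(i) gives
     phi_pi(N.X) = sum_(sigma <= pi) prod_(P in pi) C(N_P, #(sigma|P)) phi_sigma(X),
   because a family i with quasi-meet sigma is strictly increasing along the
   blocks of sigma inside each P, hence amounts to the choice, for each P, of
   a set of #(sigma|P) values below N_P ([card_qmeet_okernel]). As C(N, m) is a
   polynomial in N whose linear coefficient is (-1)^(m-1)/m, the coefficient of
   N_1 ... N_p is sum_(sigma <= pi) mu(sigma, pi) phi_sigma(X). This proves the
   first formula once the coefficient is known to depend only on the values at
   positive integers; interpolation weights show this ([cumulantE]).

   The second formula follows from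
     sum_(tau <= sigma <= pi) zeta(sigma, pi) mu(tau, sigma) = [pi = tau]
   ([mu_zeta_inverse]), which needs no description of the interval [tau, pi].
   Put all N_P equal to N and let C_N(pi, tau) be the resulting
   number of families. Pairing a family below M with a family below N, in
   lexicographic order, gives a family below MN, so that C_M C_N = C_(MN) as
   matrices ([card_polyM]). Hence the matrices C^(k) of coefficients of N^k are
   idempotent, and they add up to C_1, the identity. If
   nonzero, the entry (pi, sigma) of C_N has degree |sigma| and top coefficient
   zeta(sigma, pi), and the entry (sigma, tau) has order |sigma| at 0 and lowest
   coefficient mu(tau, sigma). In sum_sigma C^(k)(pi, sigma) C^(k)(sigma, tau) only the
   sigma with |sigma| = k survive, and summing over k gives the identity. *)

Set Implicit Arguments.
Unset Strict Implicit.
Unset Printing Implicit Defensive.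

Import GRing.Theory.

(** * Ordered set partitions as total preorders *)

Section WeakOrder.
Variable n : nat.
Implicit Types (pi sigma tau : OP n) (k l : 'I_n).

Definition weak_order pi : rel 'I_n :=
  fun k l => (block_index pi k <= block_index pi l)%N.

(** Both block numberings take all values of an initial segment of the natural
   numbers, so each of them is the rank function of the common preorder. *)
Lemma weak_order_inj pi sigma : weak_order pi =2 weak_order sigma -> pi = sigma.
Proof.
move=> eq_ord.
have le_index (rho rho' : OP n) : weak_order rho =2 weak_order rho' ->
    forall m k, block_index rho k = m :> nat -> (m <= block_index rho' k)%N.
  move=> eq_rr'; elim=> [//|m IHm] k km.
  have mp : (m < size rho)%N by have := ltn_ord (block_index rho k); lia.
  have [l /(congr1 val)/= lm] := block_index_surj (Ordinal mp).
  have := eq_rr' k l; rewrite /weak_order km {1}/block_index /= lm ltnn.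
  by move/esym/negbT; rewrite -ltnNge; apply: leq_ltn_trans (IHm l lm).
rewrite -(okernel_block_index pi) -(okernel_block_index sigma).
suff eq_b : (fun k => block_index pi k : nat) =1 (fun k => block_index sigma k).
  do 2 apply: val_inj; rewrite /= /okernel_seq (eq_codom eq_b).
  by apply: eq_map => v; apply/setP=> k; rewrite !inE; congr (_ == v); apply: eq_b.
move=> k; apply/eqP; rewrite eqn_leq (le_index pi) //=.
by rewrite (le_index sigma) // => ? ?; rewrite eq_ord.
Qed.

Lemma mem_block pi k : k \in nth set0 pi (block_index pi k).
Proof. by rewrite mem_nth_osp. Qed.

(** The blocks of a quasi-meet are obtained from a list of intersections by
   deleting empty sets, which shifts their positions; a criterion through
   [pairwise] is stable under such deletions. *)
Lemma weak_order_pairwise pi (r : rel 'I_n) :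
    pairwise (fun P Q : {set 'I_n} =>
      [forall k in P, forall l in Q, r k l && ~~ r l k]) pi ->
    (forall P k l, P \in (pi : seq _) -> k \in P -> l \in P -> r k l) ->
  weak_order pi =2 r.
Proof.
move=> /(pairwiseP set0) r_lt r_eq k l; rewrite /weak_order.
have step a b : (block_index pi a < block_index pi b)%N -> r a b && ~~ r b a.
  move=> ab; have := r_lt _ _ (ltn_ord _) (ltn_ord _) ab.
  by move=> /forall_inP/(_ _ (mem_block pi a))/forall_inP/(_ _ (mem_block pi b)).
case: ltngtP => [/step/andP[]//|/step/andP[_ /negPf]//|eq_kl].
apply/esym/(r_eq (nth set0 pi (block_index pi k))); first exact: mem_nth.
  exact: mem_block.
by rewrite eq_kl mem_block.
Qed.

Lemma block_index_pairwise pi :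
  pairwise (fun P Q : {set 'I_n} => [forall k in P, forall l in Q,
    (block_index pi k < block_index pi l)%N]) pi.
Proof.
apply/(pairwiseP set0) => a b; rewrite !inE => ap bp ab.
apply/forall_inP=> k; rewrite mem_nth_osp // => /eqP->.
by apply/forall_inP=> l; rewrite mem_nth_osp // => /eqP->.
Qed.

Lemma block_index_const pi P k l :
  P \in (pi : seq _) -> k \in P -> l \in P -> block_index pi k = block_index pi l.
Proof.
move=> /(nthP set0)[m mp <-]; rewrite !mem_nth_osp // => /eqP km /eqP lm.
by apply: val_inj; apply: etrans km (esym lm).
Qed.

Lemma weak_order_okernel (i : 'I_n -> nat) :
  weak_order (okernel i) =2 (fun k l => i k <= i l)%N.
Proof.
apply: weak_order_pairwise => [|P k l /mapP[v _ ->]]; last first.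
  by rewrite !inE => /eqP-> /eqP->.
rewrite pairwise_map.
have : sorted ltn (sort leq (undup (codom i))).
  by rewrite ltn_sorted_uniq_leq sort_uniq undup_uniq (sort_sorted leq_total).
rewrite (sorted_pairwise ltn_trans); apply: sub_pairwise => v w /= vw.
apply/forall_inP=> k; rewrite inE => /eqP->.
by apply/forall_inP=> l; rewrite inE => /eqP->; rewrite (ltnW vw) -ltnNge.
Qed.

Lemma weak_order_qmeet pi sigma :
  weak_order (qmeet pi sigma) =2 (fun k l =>
    (block_index pi k < block_index pi l) ||
    (block_index pi k == block_index pi l) && weak_order sigma k l)%N.
Proof.
apply: weak_order_pairwise => [|P k l]; last first.
  rewrite mem_filter => /andP[_ /allpairsP[[Q Q'] /= [Qpi Q's ->]]].
  rewrite !inE => /andP[kQ kQ'] /andP[lQ lQ'].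
  by rewrite (block_index_const Qpi kQ lQ) /weak_order
    (block_index_const Q's kQ' lQ') eqxx leqnn orbT.
apply: (subseq_pairwise (filter_subseq _ _)).
(* The blocks of pi are replaced by an arbitrary s to allow induction on s,
   while block_index still refers to pi. *)
suff pw (s : seq {set 'I_n}) :
    pairwise (fun P Q : {set 'I_n} => [forall k in P, forall l in Q,
      (block_index pi k < block_index pi l)%N]) s ->
    (forall (P : {set 'I_n}) k l, P \in s -> k \in P -> l \in P ->
      block_index pi k = block_index pi l) ->
    pairwise (fun P Q : {set 'I_n} => [forall k in P, forall l in Q,
      ((block_index pi k < block_index pi l) ||
       (block_index pi k == block_index pi l) && weak_order sigma k l)%N &&
      ~~ ((block_index pi l < block_index pi k) ||
       (block_index pi l == block_index pi k) && weak_order sigma l k)%N])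
      [seq P :&: Q | P <- s, Q <- (sigma : seq _)].
  by apply: pw (block_index_pairwise pi) (@block_index_const pi).
elim: s => [//|P s IHs]; rewrite allpairs_cons pairwise_cons.
move=> /andP[Ps sd] s_eq.
rewrite pairwise_cat IHs //; last first.
  by move=> Q k l Qs kQ lQ; apply: (s_eq Q) => //; rewrite inE Qs orbT.
rewrite andbT; apply/andP; split.
  apply/allrelP => _ _ /mapP[S _ ->] /allpairsP[[P' S'] [P's _ ->]].
  apply/forall_inP=> k /setIP[kP _]; apply/forall_inP=> l /setIP[lP' _].
  move/allP/(_ _ P's)/forall_inP/(_ k kP)/forall_inP/(_ l lP'): Ps.
  by rewrite -!(inj_eq val_inj); case: ltngtP.
rewrite pairwise_map; apply: sub_pairwise (block_index_pairwise sigma).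
move=> S S' SS'; apply/forall_inP=> k /setIP[kP kS].
apply/forall_inP=> l /setIP[lP lS'].
rewrite (s_eq P k l) ?mem_head // ltnn eqxx /= /weak_order.
move/forall_inP/(_ k kS)/forall_inP/(_ l lS'): SS' => SS'.
by rewrite (ltnW SS') -ltnNge.
Qed.

Lemma osp_leP tau pi :
  reflect (subrel (weak_order tau) (weak_order pi)) (osp_le tau pi).
Proof.
apply: (iffP andP) => [[/allP tau_sub tau_ord] k l|tau_pi].
  move/'forall_'forall_'forall_'forall_implyP: tau_ord => tau_ord.
  have mem_sub (a : 'I_(size tau)) : exists b : 'I_(size pi),
      nth set0 tau a \subset nth set0 pi b.
    have /hasP[Q Qpi sub] := tau_sub _ (mem_nth set0 (ltn_ord a)).
    move: (Qpi); rewrite -index_mem => lt_Q.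
    by exists (Ordinal lt_Q); rewrite /= nth_index.
  have sub_index a (b : 'I_(size pi)) m :
      nth set0 tau (block_index tau a) \subset nth set0 pi b ->
      m \in nth set0 tau (block_index tau a) -> b = block_index pi m.
    by move=> /subsetP/(_ m) sub /sub; rewrite mem_nth_osp // => /eqP/val_inj.
  have [a sub_a] := mem_sub (block_index tau k).
  have [b sub_b] := mem_sub (block_index tau l).
  have ak := sub_index _ _ _ sub_a (mem_block tau k).
  have bl := sub_index _ _ _ sub_b (mem_block tau l).
  rewrite /weak_order leq_eqVlt => /orP[/eqP kl|kl].
    by rewrite -ak (sub_index _ _ l sub_a) // kl mem_block.
  by rewrite -ak -bl; apply: (tau_ord _ _ _ _); apply/and3P; split; eassumption.
have const k l : block_index tau k = block_index tau l :> nat ->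
    block_index pi k = block_index pi l.
  move=> kl; apply/val_inj/eqP; rewrite eqn_leq.
  by apply/andP; split; apply: tau_pi; rewrite /weak_order kl.
split.
  apply/allP=> P /(nthP set0)[m mt <-].
  have [k /(congr1 val) /= km] := block_index_surj (Ordinal mt).
  apply/hasP; exists (nth set0 pi (block_index pi k)); first exact: mem_nth.
  apply/subsetP=> l; rewrite !mem_nth_osp // => /eqP lm.
  by rewrite (const l k) //; apply: etrans lm (esym km).
apply/'forall_'forall_'forall_'forall_implyP=> i j a b /and3P[ij sub_i sub_j].
have [k ki] := block_index_surj i; have [l lj] := block_index_surj j.
move: (subsetP sub_i k) (subsetP sub_j l); rewrite -ki -lj !mem_block !mem_nth_osp //.
move=> /(_ isT)/eqP<- /(_ isT)/eqP<-; apply: tau_pi.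
by rewrite /weak_order ki lj ltnW.
Qed.

End WeakOrder.

(** * The number of index families with a given quasi-meet *)

(** Both images are in bijection with the image of the pairing (f, g). *)
Lemma card_imset_eq (T U V : finType) (P : {set T}) (f : T -> U) (g : T -> V) :
  {in P &, forall k l, (f k == f l) = (g k == g l)} -> #|f @: P| = #|g @: P|.
Proof.
move=> fg; pose h k := (f k, g k).
transitivity #|h @: P|.
  rewrite -[f @: P]/((fst \o h) @: P) imset_comp; apply: card_in_imset.
  move=> a b /imsetP[k kP ->{a}] /imsetP[l lP ->{b}] /= /eqP fkl.
  by apply/eqP; rewrite xpair_eqE fkl -fg.
rewrite -[g @: P]/((snd \o h) @: P) imset_comp; apply/esym/card_in_imset.
move=> a b /imsetP[k kP ->{a}] /imsetP[l lP ->{b}] /= /eqP gkl.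
by apply/eqP; rewrite xpair_eqE gkl fg ?gkl.
Qed.

Definition ord_vals m (A : {set 'I_m}) : seq nat := [seq val x | x <- enum A].

Lemma ord_vals_sorted m (A : {set 'I_m}) : sorted ltn (ord_vals A).
Proof.
rewrite /ord_vals (sorted_map (e' := ltn)) /enum_mem.
apply: sorted_filter; first by move=> ? ? ?; apply: ltn_trans.
by rewrite -enumT -(sorted_map (e' := ltn)) val_enum_ord iota_ltn_sorted.
Qed.

Lemma size_ord_vals m (A : {set 'I_m}) : size (ord_vals A) = #|A|.
Proof. by rewrite size_map -cardE. Qed.

Lemma mem_ord_vals m (A : {set 'I_m}) (x : 'I_m) : (val x \in ord_vals A) = (x \in A).
Proof. by rewrite mem_map ?mem_enum //; apply: val_inj. Qed.

(** The order isomorphism between two finite sets of naturals of the same size,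
   listed increasingly. *)
Lemma sorted_nth_index (s t : seq nat) x y :
    sorted ltn s -> sorted ltn t -> size s = size t -> x \in t -> y \in t ->
  (nth 0 s (index x t) <= nth 0 s (index y t))%N = (x <= y)%N.
Proof.
move=> s_lt t_lt eq_st; have step a b : a \in t -> b \in t -> (a < b)%N ->
    (nth 0 s (index a t) < nth 0 s (index b t))%N.
  move=> at_ bt ab; apply: (sorted_ltn_nth ltn_trans); rewrite ?inE ?eq_st ?index_mem //.
  have t_le : sorted leq t by apply: sub_sorted t_lt => ? ?; apply: ltnW.
  rewrite ltnNge; apply: contraTN ab => /(sorted_leq_index leq_trans leqnn t_le).
  by rewrite -leqNgt; apply.
move=> xt yt; case: (ltngtP x y) => [xy|yx|->]; last by rewrite leqnn.
  by rewrite ltnW ?step.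
by rewrite leqNgt step.
Qed.

Section Counting.
Variable n : nat.
Implicit Types (pi sigma tau : OP n) (k l : 'I_n).

Lemma mem_nth_block pi (j : 'I_(size pi)) k :
  (k \in nth set0 pi j) = (block_index pi k == j).
Proof. by rewrite mem_nth_osp. Qed.

Lemma size_restr tau (P : {set 'I_n}) : size (restr tau P) = #|block_index tau @: P|.
Proof.
rewrite size_filter count_map -sum1_count (big_nth set0) big_mkord sum1dep_card.
congr #|pred_of_set _|; apply/setP=> a; rewrite inE /=.
apply/set0Pn/imsetP=> [[k /setIP[kP]]|[k kP ->]].
  by rewrite mem_nth_block => /eqP <-; exists k.
by exists k; rewrite inE kP mem_nth_block eqxx.
Qed.

Lemma qmeet_okernelP pi tau (i : 'I_n -> nat) :
  reflect (osp_le tau pi /\ forall k l, block_index pi k = block_index pi l ->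
             (i k <= i l)%N = weak_order tau k l)
          (qmeet pi (okernel i) == tau).
Proof.
apply: (iffP eqP) => [<-|[/osp_leP tau_pi i_tau]].
  split=> [|k l eq_kl]; last first.
    by rewrite weak_order_qmeet eq_kl ltnn eqxx weak_order_okernel.
  apply/osp_leP=> k l; rewrite weak_order_qmeet /weak_order.
  by case/orP=> [/ltnW//|/andP[/eqP-> _]].
apply: weak_order_inj => k l; rewrite weak_order_qmeet weak_order_okernel.
rewrite -!(inj_eq val_inj); case: ltngtP => [lt_kl|lt_lk|/val_inj/i_tau->] //=.
  apply/esym; have /contra := tau_pi l k.
  by rewrite /weak_order -!ltnNge => /(_ lt_kl)/ltnW.
by apply/esym/negbTE; apply: contraTN lt_lk => /tau_pi; rewrite /weak_order -leqNgt.
Qed.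

(** Inside a block P_j of pi, such a family is an order isomorphism from the
   set of tau-blocks meeting P_j to its set of values; it is determined by
   that set of values, which can be any subset of [0, N_j) of the right size. *)
Lemma card_qmeet_okernel pi tau (N : 'I_(size pi) -> nat) :
  #|[set i : {dffun forall k : 'I_n, 'I_(N (block_index pi k))} |
      qmeet pi (okernel (fun k => i k)) == tau]| =
  (osp_le tau pi * \prod_j 'C(N j, size (restr tau (nth set0 pi j))))%N.
Proof.
have [tau_pi|ntau_pi] := boolP (osp_le tau pi); last first.
  rewrite mul0n; apply: eq_card0 => i; rewrite inE; apply: contraNF ntau_pi.
  by case/qmeet_okernelP.
rewrite mul1n; pose M := \max_j N j.
have N_M j : (N j <= M)%N by apply: leq_bigmax.
pose v (i : {dffun forall k : 'I_n, 'I_(N (block_index pi k))}) k : 'I_M :=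
  widen_ord (N_M _) (i k).
(* The types 'I_(N j) vary with j: all value sets are taken in 'I_M so that
   they form an ordinary finite function. *)
pose F i := [ffun j : 'I_(size pi) => v i @: nth set0 pi j].
pose G (j : 'I_(size pi)) := [set A : {set 'I_M} |
  A \subset [set x : 'I_M | (x < N j)%N] & #|A| == size (restr tau (nth set0 pi j))].
have card_G j : #|G j| = 'C(N j, size (restr tau (nth set0 pi j))).
  rewrite cards_draws; congr 'C(_, _).
  have -> : [set x : 'I_M | (x < N j)%N] = widen_ord (N_M j) @: setT.
    apply/setP=> x; rewrite inE; apply/idP/imsetP=> [xj|[y _ ->]]; last exact: (ltn_ord y).
    by exists (Ordinal xj); rewrite ?inE //; apply: val_inj.
  rewrite card_imset ?cardsT ?card_ord // => x y /(congr1 val) /= xy.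
  exact: val_inj.
transitivity #|family G|; last first.
  by rewrite card_family foldrE big_map enumT; apply: eq_bigr => j _; rewrite card_G.
set D := [set i | _].
have in_block k l : block_index pi k = block_index pi l ->
  l \in nth set0 pi (block_index pi k) by move=> ->; apply: mem_block.
have F_inj : {in D &, injective F}.
  (* The value at k is the element of the value set whose rank is the number
     of tau-blocks that meet the pi-block of k and precede the tau-block
     of k. *)
  move=> i i' iD i'D Fii'; apply/ffunP=> k; apply: val_inj.
  have rank_v i0 : i0 \in D ->
      #|[set x in v i0 @: nth set0 pi (block_index pi k) | (x < v i0 k)%N]| =
      #|block_index tau @: [set l in nth set0 pi (block_index pi k) |
          (block_index tau l < block_index tau k)%N]|.
    rewrite inE => /qmeet_okernelP[_ i0D].
    rewrite (@card_imset_eq _ _ _ _ _ (v i0)) => [|l l'].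
      congr #|pred_of_set _|; apply/setP=> x; rewrite inE.
      apply/andP/imsetP=> [[/imsetP[l lk ->{x}] lt_lk]|[l]].
        exists l; rewrite // inE lk; move: lk lt_lk; rewrite mem_nth_block.
        by move=> /eqP lk; rewrite /= !ltnNge i0D.
      rewrite inE => /andP[lk lt_lk] ->{x}; rewrite imset_f //.
      move: lk lt_lk; rewrite mem_nth_block => /eqP lk.
      by rewrite /= !ltnNge i0D.
    rewrite !inE !mem_nth_block => /andP[/eqP lk _] /andP[/eqP l'k _].
    by rewrite -!(inj_eq val_inj) /= !eqn_leq !i0D ?lk ?l'k.
  have rank_lt (A : {set 'I_M}) (x y : 'I_M) : x \in A -> (x < y)%N ->
      (#|[set z in A | (z < x)%N]| < #|[set z in A | (z < y)%N]|)%N.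
    move=> xA xy; apply/proper_card/properP; split.
      by apply/subsetP=> z; rewrite !inE => /andP[-> /ltn_trans->].
    by exists x; rewrite !inE xA ?xy ?ltnn.
  have /ffunP/(_ (block_index pi k)) := Fii'; rewrite !ffunE => eqW.
  have vk : v i k \in v i' @: nth set0 pi (block_index pi k).
    by rewrite -eqW imset_f ?mem_block.
  have v'k : v i' k \in v i' @: nth set0 pi (block_index pi k).
    by rewrite imset_f ?mem_block.
  have := rank_v _ i'D; rewrite -(rank_v _ iD) eqW.
  case: (ltngtP (v i k) (v i' k)) => [lt_v|lt_v|//] eq_rank.
    by have := rank_lt _ _ _ vk lt_v; rewrite eq_rank ltnn.
  by have := rank_lt _ _ _ v'k lt_v; rewrite eq_rank ltnn.
rewrite -(card_in_imset F_inj); apply: eq_card => A.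
apply/imsetP/familyP => [[i iD ->] j|A_G].
  rewrite ffunE inE; apply/andP; split.
    apply/subsetP=> x /imsetP[k]; rewrite mem_nth_block => /eqP kj ->{x}.
    by rewrite inE /= -kj.
  apply/eqP; rewrite size_restr; apply: card_imset_eq => k l.
  rewrite !mem_nth_block => /eqP kj /eqP lj; rewrite -!(inj_eq val_inj) /=.
  move: iD; rewrite inE => /qmeet_okernelP[_ iD].
  by rewrite !eqn_leq !iD ?kj ?lj.
(* Conversely, the sets A are realized by sending the r-th tau-block inside P_j
   to the r-th element of A_j. *)
pose V j := block_index tau @: nth set0 pi j.
pose u k := nth 0%N (ord_vals (A (block_index pi k)))
  (index (block_index tau k : nat) (ord_vals (V (block_index pi k)))).
have size_A j : size (ord_vals (A j)) = size (ord_vals (V j)).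
  rewrite !size_ord_vals; have := A_G j; rewrite inE => /andP[_ /eqP->].
  by rewrite size_restr.
have in_V k l : block_index pi k = block_index pi l ->
    (block_index tau l : nat) \in ord_vals (V (block_index pi k)).
  by move=> kl; rewrite mem_ord_vals imset_f ?in_block.
have u_mem k : exists2 x, x \in A (block_index pi k) & u k = val x.
  have : u k \in ord_vals (A (block_index pi k)).
    by apply: mem_nth; rewrite size_A index_mem in_V.
  by case/mapP=> x; rewrite mem_enum; exists x.
have u_lt k : (u k < N (block_index pi k))%N.
  have [x xA ->] := u_mem k; have := A_G (block_index pi k).
  by rewrite inE => /andP[/subsetP/(_ x xA)]; rewrite inE.
pose i : {dffun forall k : 'I_n, 'I_(N (block_index pi k))} :=
  finfun (fun k => Ordinal (u_lt k)).
have iE k : i k = u k :> nat by rewrite ffunE.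
have iD : i \in D.
  rewrite inE; apply/qmeet_okernelP; split=> // k l kl.
  rewrite !iE /u -kl sorted_nth_index ?ord_vals_sorted ?in_V //.
exists i => //; apply/ffunP=> j; rewrite ffunE; apply/esym/eqP.
have sub_A : v i @: nth set0 pi j \subset A j.
  apply/subsetP=> x /imsetP[k]; rewrite mem_nth_block => /eqP <- ->{x}.
  have [x xA ukx] := u_mem k; suff -> : v i k = x by [].
  by apply: val_inj; rewrite /= iE.
rewrite eqEcard sub_A.
have := A_G j; rewrite inE => /andP[_ /eqP->]; rewrite size_restr.
rewrite (@card_imset_eq _ _ _ _ (block_index tau) (v i)) ?leqnn // => k l.
rewrite !mem_nth_block => /eqP kj /eqP lj; rewrite -!(inj_eq val_inj) /=.
move: iD; rewrite inE => /qmeet_okernelP[_ iD].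
by rewrite !eqn_leq !iD ?kj ?lj.
Qed.

(** The preorder of an iterated quasi-meet is lexicographic, and for j < N the
   number i N + j encodes the lexicographic order of the pairs (i, j). *)
Lemma qmeet_okernel_lex pi N (i j : 'I_n -> nat) : (forall k, j k < N)%N ->
  qmeet (qmeet pi (okernel i)) (okernel j) =
  qmeet pi (okernel (fun k => i k * N + j k)%N).
Proof.
move=> jN; apply: weak_order_inj => k l.
have ltE (rho : OP n) a b :
    (block_index rho a < block_index rho b)%N = ~~ weak_order rho b a.
  by rewrite ltnNge.
have eqE (rho : OP n) a b : (block_index rho a == block_index rho b) =
    weak_order rho a b && weak_order rho b a.
  by rewrite -(inj_eq val_inj) eqn_leq.
rewrite weak_order_qmeet (ltE (qmeet _ _)) (eqE (qmeet _ _)).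
rewrite !weak_order_qmeet !weak_order_okernel.
rewrite ![block_index pi l == _]eq_sym -![block_index pi k == _](inj_eq val_inj).
have jk := jN k; have jl := jN l.
case: (ltngtP (block_index pi k) (block_index pi l)) => //= _.
case: (ltngtP (i k) (i l)) => [ikl|ilk|->] /=; last by rewrite leq_add2l.
  by apply/esym; nia.
by apply/esym/negbTE; rewrite -ltnNge; nia.
Qed.

End Counting.

(** * Binomial coefficients as polynomials *)

Local Open Scope ring_scope.

Section Polynomials.
Variables (K : fieldType) (charK : [pchar K] =i pred0).

Lemma natr_neq0 m : (0 < m)%N -> m%:R != 0 :> K.
Proof. by move/pcharf0P: charK => ->; rewrite lt0n. Qed.

Lemma natr_inj : injective (fun m : nat => m%:R : K).
Proof.
have wlog_inj a b : (a <= b)%N -> a%:R = b%:R :> K -> a = b.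
  move=> ab /eqP; rewrite eq_sym -subr_eq0 -natrB //.
  by move/pcharf0P: charK => ->; lia.
by move=> a b ab; case: (leqP a b) => [|/ltnW] /wlog_inj->.
Qed.

Lemma poly_natr_eq0 (p : {poly K}) : (forall m : nat, p.[m%:R] = 0) -> p = 0.
Proof.
move=> p0; apply/eqP/negPn/negP=> nz_p.
have := max_poly_roots (rs := [seq m%:R | m <- iota 0 (size p)]) nz_p.
rewrite size_map size_iota ltnn map_inj_uniq ?iota_uniq; last exact: natr_inj.
suff /[swap]/[apply]/(_ isT) : all (root p) [seq m%:R | m <- iota 0 (size p)] by [].
 apply/allP=> x /mapP[m _ ->].
by rewrite /root p0.
Qed.

Definition bin_poly m : {poly K} :=
  (m`!)%:R^-1 *: \prod_(i < m) ('X - (i%:R)%:P).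

Lemma horner_bin_poly m N : (bin_poly m).[N%:R] = 'C(N, m)%:R.
Proof.
rewrite hornerZ; have -> : (\prod_(i < m) ('X - (i%:R)%:P)).[N%:R] = (N ^_ m)%:R :> K.
  elim: m => [|m IHm]; first by rewrite big_ord0 hornerC.
  rewrite big_ord_recr hornerM IHm hornerXsubC ffactnSr.
  have [mN|Nm] := leqP m N; first by rewrite -natrB // natrM.
  by rewrite ffact_small // mul0r mul0n.
by rewrite -bin_ffact natrM mulrC mulfK // natr_neq0 // fact_gt0.
Qed.

Lemma size_bin_poly m : size (bin_poly m) = m.+1.
Proof.
rewrite size_scale ?invr_eq0 ?natr_neq0 ?fact_gt0 //.
by rewrite -big_enum /= size_prod_XsubC size_enum_ord.
Qed.

Lemma lead_coef_bin_poly m : lead_coef (bin_poly m) = (m`!)%:R^-1.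
Proof. by rewrite lead_coefZ (monicP (monic_prod_XsubC _ _ _)) mulr1. Qed.

Definition bin_poly_quo m : {poly K} :=
  (m`!)%:R^-1 *: \prod_(i < m.-1) ('X - (i.+1%:R)%:P).

Lemma bin_polyE m : (0 < m)%N -> bin_poly m = 'X * bin_poly_quo m.
Proof.
case: m => // m _; rewrite /bin_poly /bin_poly_quo big_ord_recl subr0.
by rewrite -scalerAr.
Qed.

Lemma bin_poly_quo0 m : (0 < m)%N -> (bin_poly_quo m)`_0 = (-1) ^+ m.-1 / m%:R.
Proof.
case: m => // m _; rewrite /bin_poly_quo -horner_coef0 hornerZ horner_prod /=.
under eq_bigr do rewrite hornerXsubC sub0r -mulN1r.
rewrite big_split /= prodr_const card_ord -natr_prod.
rewrite -(big_mkord xpredT S) -(big_add1 _ _ 0 m.+1 xpredT id) -fact_prod.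
rewrite factS natrM.
by rewrite invfM mulrACA mulVf ?natr_neq0 ?fact_gt0 // mulr1 mulrC.
Qed.

Lemma coef1_bin_poly m : (0 < m)%N -> (bin_poly m)`_1 = (-1) ^+ m.-1 / m%:R.
Proof. by move=> m0; rewrite bin_polyE // coefXM bin_poly_quo0. Qed.

(** Each factor has a simple zero at 0, so the product starts in degree p. *)
Lemma coef_prod_bin_poly_low p (m : 'I_p -> nat) : (forall j, 0 < m j)%N ->
  forall k, (k <= p)%N -> (\prod_j bin_poly (m j))`_k =
    if k == p then \prod_j (bin_poly (m j))`_1 else 0.
Proof.
move=> m0 k kp; rewrite (eq_bigr (fun j => 'X * bin_poly_quo (m j))); last first.
  by move=> j _; rewrite bin_polyE.
rewrite big_split prodr_const card_ord /= coefXnM.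
case: ltngtP kp => // -> _; rewrite subnn -horner_coef0 horner_prod.
by apply: eq_bigr => j _; rewrite horner_coef0 coef1_bin_poly // bin_poly_quo0.
Qed.

Lemma size_prod_bin_poly p (m : 'I_p -> nat) :
  size (\prod_j bin_poly (m j)) = (\sum_j m j).+1.
Proof.
rewrite size_prod => [|j _]; last by rewrite -size_poly_gt0 size_bin_poly.
under eq_bigr do rewrite size_bin_poly -addn1.
by rewrite big_split sum1_card card_ord /=; lia.
Qed.

Lemma coef_prod_bin_poly_top p (m : 'I_p -> nat) :
  (\prod_j bin_poly (m j))`_(\sum_j m j)%N = \prod_j ((m j)`!)%:R^-1.
Proof.
rewrite -[(\sum_j m j)%N]/(\sum_j m j).+1.-1 -size_prod_bin_poly -lead_coefE.
rewrite lead_coef_prod.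
by apply: eq_bigr => j _; rewrite lead_coef_bin_poly.
Qed.

(** The linear coefficient is read off from the values at 1, ..., D because the
   Vandermonde matrix of these points is invertible. *)
Lemma linear_coef_weights D : exists lam : 'I_D -> K, forall q : {poly K},
  (size q <= D)%N -> \sum_t lam t * q.[t.+1%:R] = q`_1.
Proof.
pose V := Vandermonde D (\row_(t < D) (t.+1%:R : K)).
have unitV : V \in unitmx.
  rewrite unitmxE det_Vandermonde unitfE; apply/prodf_neq0 => i _.
  apply/prodf_neq0 => j ij; rewrite !mxE subr_eq0.
  by apply: contraTneq ij => /natr_inj[->]; rewrite ltnn.
pose e : 'cV[K]_D := \col_i (i == 1 :> nat)%:R.
exists (fun t => (invmx V *m e) t 0) => q qD.
have VlamE : V *m (invmx V *m e) = e by rewrite mulKVmx.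
transitivity (\sum_(a < D) q`_a * (a == 1 :> nat)%:R).
  under eq_bigr do rewrite (horner_coef_wide _ qD) mulr_sumr.
  rewrite exchange_big /=; apply: eq_bigr => a _.
  have /matrixP/(_ a 0) := VlamE; rewrite !mxE => <-.
  by rewrite mulr_sumr; apply: eq_bigr => t _; rewrite !mxE; ring.
have [D1|D1] := ltnP 1 D.
  rewrite (bigD1 (Ordinal D1)) //= mulr1 big1 ?addr0 // => a.
  by rewrite -(inj_eq val_inj) /= => /negPf->; rewrite mulr0.
rewrite nth_default ?(leq_trans qD) // big1 // => a _.
by rewrite ltn_eqF ?mulr0 // (leq_trans (ltn_ord a)).
Qed.

(** Multiplicativity in the argument becomes, coefficient by coefficient,
   idempotency: the monomial M^k N^l with k <> l does not occur on the left. *)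
Lemma coef_semigroup (I : finType) (c : {poly K}) (a b : I -> {poly K}) :
    (forall M N : nat, c.[(M * N)%:R] = \sum_s (a s).[M%:R] * (b s).[N%:R]) ->
  forall k, c`_k = \sum_s (a s)`_k * (b s)`_k.
Proof.
move=> cab k.
(* Compare the coefficients of M^k for fixed N, then those of N^k. *)
have step N : c`_k * N%:R ^+ k = \sum_s (a s)`_k * (b s).[N%:R].
  pose p := c \Po (N%:R *: 'X) - \sum_s (b s).[N%:R] *: a s.
  have p0 : p = 0.
    apply: poly_natr_eq0 => M; rewrite hornerD hornerN horner_comp hornerZ hornerX.
    rewrite -natrM mulnC cab horner_sum; apply/eqP; rewrite subr_eq0; apply/eqP.
    by apply: eq_bigr => s _; rewrite hornerZ mulrC.
  move/polyP/(_ k): p0; rewrite /p coefB coef0 coef_sum => /eqP.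
  rewrite subr_eq0 => /eqP; under [RHS]eq_bigr do rewrite coefZ mulrC.
  move=> <-; rewrite comp_polyE coef_sum.
  have [kc|ck] := ltnP k (size c).
    rewrite (bigD1 (Ordinal kc)) //= big1 => [|i ik]; rewrite exprZn !coefZ coefXn.
      by rewrite eqxx mulr1 addr0.
    by move: ik; rewrite -(inj_eq val_inj) eq_sym /= => /negPf->; rewrite !mulr0.
  rewrite nth_default // mul0r big1 // => i _; rewrite exprZn !coefZ coefXn.
  by rewrite gtn_eqF ?mulr0 //; apply: leq_trans ck.
pose p := c`_k *: 'X^k - \sum_s (a s)`_k *: b s.
have p0 : p = 0.
  apply: poly_natr_eq0 => N; rewrite hornerD hornerN hornerZ hornerXn step horner_sum.
  by apply/eqP; rewrite subr_eq0; apply/eqP; apply: eq_bigr => s _; rewrite hornerZ.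
move/polyP/(_ k): p0; rewrite /p coefB coef0 coef_sum => /eqP.
rewrite subr_eq0 coefZ coefXn eqxx mulr1 => /eqP->.
by apply: eq_bigr => s _; rewrite coefZ.
Qed.

End Polynomials.

(** * Polynomials with vector coefficients *)

Section PolynomialFamilies.
Variables (K : fieldType) (charK : [pchar K] =i pred0) (B : assocAlgType K) (p : nat).

Lemma poly_eval_prod (I : finType) (q : I -> 'I_p -> {poly K}) (b : I -> B) :
  exists c : {fsfun {ffun 'I_p -> nat} -> B with 0}, forall N,
    poly_eval c N = \sum_s (\prod_j (q s j).[(N j)%:R]) *: b s.
Proof.
pose D := (\max_s \max_j size (q s j))%N.
have qD s j : (size (q s j) <= D)%N.
  by apply: leq_trans (leq_bigmax s); apply: (leq_bigmax j).
(* All exponents lie in the box [0, D)^p, where D bounds every size (degree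
   plus one); e embeds the box in the exponents. *)
pose e (t : {ffun 'I_p -> 'I_D}) : {ffun 'I_p -> nat} := [ffun j => t j : nat].
have e_inj : injective e.
  by move=> t u /ffunP tu; apply/ffunP=> j; apply: val_inj; have := tu j; rewrite !ffunE.
pose supp := [fset e t | t in {: {ffun 'I_p -> 'I_D}}]%fset.
pose f (a : {ffun 'I_p -> nat}) := \sum_s (\prod_j (q s j)`_(a j)) *: b s.
exists [fsfun a in supp => f a] => N; rewrite /poly_eval.
rewrite (big_fset_incl _ (finsupp_sub _ _ _)) => [|a aS]; last first.
  by rewrite memNfinsupp => /eqP->; rewrite scaler0.
rewrite big_imfset /=; last by move=> t u _ _; apply: e_inj.
rewrite big_enum /=.
under eq_bigr => t _.
  rewrite fsfunE in_imfset // /f scaler_sumr.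
  over.
rewrite exchange_big /=; apply: eq_bigr => s _.
under eq_bigr do rewrite scalerA -big_split /=.
rewrite -scaler_suml; congr (_ *: _).
under [RHS]eq_bigr do rewrite (horner_coef_wide _ (qD s _)).
rewrite bigA_distr_bigA /=; apply: eq_bigr => t _; apply: eq_bigr => j _.
by rewrite ffunE mulrC.
Qed.

(** The coefficient of N_1 ... N_p is determined by the values at positive
   integers: tensor powers of the one-variable weights extract it. *)
Lemma poly_eval_linear_coef D (lam : 'I_D -> K)
    (c : {fsfun {ffun 'I_p -> nat} -> B with 0}) :
    (forall q : {poly K}, (size q <= D)%N -> \sum_t lam t * q.[t.+1%:R] = q`_1) ->
    (forall a j, a \in finsupp c -> (a j < D)%N) ->
  \sum_(t : {ffun 'I_p -> 'I_D}) (\prod_j lam (t j)) *: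
      poly_eval c (fun j => (t j).+1) =
  c [ffun=> 1%N].
Proof.
move=> lamP cD; rewrite /poly_eval.
under eq_bigr do rewrite scaler_sumr.
rewrite exchange_big /=.
under eq_big_seq => a ac.
  under eq_bigr do rewrite scalerA -big_split /=.
  rewrite -scaler_suml -(bigA_distr_bigA (fun j (t : 'I_D) => lam t * t.+1%:R ^+ a j)) /=.
  under eq_bigr => j _.
    under eq_bigr do rewrite -hornerXn.
    rewrite lamP ?size_polyXn ?cD // coefXn.
    over.
  over.
have prod1 (a : {ffun 'I_p -> nat}) :
    \prod_j (1%N == a j)%:R = (a == [ffun=> 1%N])%:R :> K.
  have [->|] := eqVneq a; first by rewrite big1 // => j _; rewrite ffunE.
  move=> na; have /existsP[j ja] : [exists j, a j != 1%N].
    apply: contraNT na => /existsPn all1; apply/eqP/ffunP=> j.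
    by rewrite ffunE; apply/eqP/negPn/all1.
  by rewrite (bigD1 j) //= eq_sym (negPf ja) mul0r.
under eq_bigr do rewrite prod1.
have [c1|] := boolP ([ffun=> 1%N] \in finsupp c).
  rewrite (big_fsetD1 _ c1) /= eqxx scale1r big1_seq ?addr0 // => a.
  by rewrite !inE => /andP[_ /andP[/negPf-> _]]; rewrite scale0r.
move=> c1; move: (c1); rewrite memNfinsupp => /eqP->.
rewrite big1_seq // => a /andP[_ ac].
by case: eqP ac c1 => [->->//|_ _ _]; rewrite scale0r.
Qed.

End PolynomialFamilies.

(** * The incidence matrices of the counting polynomials *)

Section Incidence.
Variables (K : fieldType) (charK : [pchar K] =i pred0) (n : nat).
Implicit Types pi sigma tau : OP n.

(** Every block of tau meets exactly one block of pi. *)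
Lemma sum_size_restr tau pi : osp_le tau pi ->
  (\sum_(j < size pi) size (restr tau (nth set0 pi j)) = size tau)%N.
Proof.
move=> /osp_leP tau_pi.
(* f picks a point in each block of tau, and g sends a block of tau to the
   block of pi that contains it. *)
have [f fK] := fin_all_exists (@block_index_surj n tau).
pose g a := block_index pi (f a).
have gE k : g (block_index tau k) = block_index pi k.
  apply: val_inj; apply/eqP; rewrite eqn_leq.
  by apply/andP; split; apply: tau_pi; rewrite /weak_order fK.
rewrite -[RHS]card_ord -sum1_card (partition_big g xpredT) //=.
apply: eq_bigr => j _; rewrite sum1dep_card size_restr; congr #|pred_of_set _|.
apply/setP=> a; rewrite inE; apply/imsetP/eqP=> [[k]|<-].
  by rewrite mem_nth_block => /eqP <- ->; rewrite gE.
have [k <-] := block_index_surj a.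
by exists k; rewrite // mem_nth_block gE.
Qed.

Lemma size_restr_gt0 tau pi (j : 'I_(size pi)) : (0 < size (restr tau (nth set0 pi j)))%N.
Proof.
rewrite size_restr card_gt0; have [k <-] := block_index_surj j.
by apply/set0Pn; exists (block_index tau k); rewrite imset_f ?mem_block.
Qed.

(** The polynomial N |-> C_N(pi, tau). *)
Definition card_poly pi tau : {poly K} :=
  if osp_le tau pi then \prod_(j < size pi) bin_poly K (size (restr tau (nth set0 pi j)))
  else 0.

Lemma horner_card_poly pi tau N : (card_poly pi tau).[N%:R] =
  #|[set i : {dffun forall k : 'I_n, 'I_N} |
      qmeet pi (okernel (fun k => i k)) == tau]|%:R.
Proof.
rewrite (card_qmeet_okernel tau (fun=> N)) /card_poly.
case: ifP => _; last by rewrite horner0.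
rewrite mul1n horner_prod natr_prod; apply: eq_bigr => j _.
by rewrite horner_bin_poly.
Qed.

Lemma coef_card_poly_low pi tau k : (k <= size pi)%N ->
  (card_poly pi tau)`_k =
    if k == size pi then (if osp_le tau pi then mu_tilde K tau pi else 0) else 0.
Proof.
move=> kp; rewrite /card_poly; case: ifP => [tau_pi|_]; last by rewrite coef0 if_same.
rewrite (coef_prod_bin_poly_low charK) //; last exact: size_restr_gt0.
case: eqP => // _; rewrite /mu_tilde /bracket (big_nth set0) big_mkord natr_prod.
under eq_bigr do rewrite (coef1_bin_poly charK (size_restr_gt0 _ _)).
rewrite big_split /= prodfV prodrXr; congr (_ ^+ _ / _).
rewrite -(sum_size_restr tau_pi) -[X in (_ - X)%N]card_ord -sum1_card.
rewrite -sumnB; first by apply: eq_bigr => j _; rewrite subn1.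
by move=> j _; apply: size_restr_gt0.
Qed.

Lemma coef_card_poly_top pi tau k : (size tau <= k)%N ->
  (card_poly pi tau)`_k =
    if k == size tau then (if osp_le tau pi then zeta_tilde K tau pi else 0) else 0.
Proof.
move=> tk; rewrite /card_poly; case: ifP => [tau_pi|_]; last by rewrite coef0 if_same.
rewrite leq_eqVlt in tk; case/orP: tk => [/eqP<-|tk].
  rewrite eqxx -(sum_size_restr tau_pi) (coef_prod_bin_poly_top charK).
  by rewrite /zeta_tilde /bracket_fact (big_nth set0) big_mkord natr_prod prodfV.
by rewrite gtn_eqF // nth_default // (size_prod_bin_poly charK) sum_size_restr.
Qed.

Lemma card_poly1 pi tau : (card_poly pi tau).[1] = (pi == tau)%:R.
Proof.
rewrite -[1]/(1%:R) horner_card_poly.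
have qmeet1 (i : {dffun forall k : 'I_n, 'I_1}) : qmeet pi (okernel (fun k => i k)) = pi.
  apply: weak_order_inj => k l.
  rewrite weak_order_qmeet weak_order_okernel !ord1 leqnn andbT.
  by rewrite /weak_order -(inj_eq val_inj) orbC -leq_eqVlt.
case: eqP => [<-|pi_tau].
  rewrite (_ : [set _ | _] = setT); last by apply/setP=> i; rewrite !inE qmeet1 eqxx.
  rewrite cardsT card_dep_ffun foldrE big_map big1 // => k _.
  by rewrite card_ord.
rewrite (_ : [set _ | _] = set0) ?cards0 //; apply/setP=> i; rewrite !inE qmeet1.
exact/eqP.
Qed.

(** Both sides count the pairs (i, j) of families below M and N such that
   iterating the quasi-meet of pi with their kernels gives tau. *)
Lemma card_polyM pi tau (M N : nat) : (card_poly pi tau).[(M * N)%:R] =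
  \sum_sigma (card_poly pi sigma).[M%:R] * (card_poly sigma tau).[N%:R].
Proof.
rewrite horner_card_poly.
under eq_bigr do rewrite !horner_card_poly -natrM.
rewrite -natr_sum; congr _%:R.
pose idx L := {dffun forall k : 'I_n, 'I_L}.
have h_lt (ij : idx M * idx N) k : (ij.1 k * N + ij.2 k < M * N)%N.
  apply: (@leq_trans ((ij.1 k).+1 * N)); last by rewrite leq_mul2r ltn_ord orbT.
  by rewrite mulSn addnC ltn_add2r.
pose h (ij : idx M * idx N) : idx (M * N)%N := finfun (fun k => Ordinal (h_lt ij k)).
have hE ij k : h ij k = (ij.1 k * N + ij.2 k)%N :> nat by rewrite ffunE.
have h_inj : injective h.
  move=> [i j] [i' j'] /ffunP hij.
  have eq_k k : i k = i' k /\ j k = j' k.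
    have N0 : (0 < N)%N by apply: leq_ltn_trans (ltn_ord (j k)).
    have := congr1 val (hij k); rewrite /= !hE /= => e.
    split; apply: val_inj; [have := congr1 (divn^~ N) e | have := congr1 (modn^~ N) e].
      by rewrite /= !divnMDl // !divn_small ?addn0.
    by rewrite /= !modnMDl !modn_small.
  by congr (_, _); apply/ffunP=> k; have [] := eq_k k.
have h_bij : bijective h.
  apply: inj_card_bij => //; rewrite card_prod !card_dep_ffun !foldrE !big_map.
  rewrite -big_split /= leq_eqVlt; apply/orP; left; apply/eqP/eq_bigr => k _.
  by rewrite !card_ord.
rewrite -(on_card_preimset (onW_bij _ h_bij)).
under [RHS]eq_bigr => sigma _ do rewrite -sum1dep_card big_distrl /=.
rewrite -sum1_card.
pose qm rho L (i : idx L) := qmeet rho (okernel (fun k => i k)).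
transitivity (\sum_(i : idx M) \sum_(j : idx N | qm (qm pi M i) N j == tau) 1)%N;
  last first.
  rewrite (partition_big (qm pi M) xpredT) //=.
  by apply: eq_bigr => sigma _; apply: eq_bigr => i /eqP->; rewrite mul1n sum1dep_card.
rewrite pair_big_dep; apply: eq_bigl => -[i j]; rewrite !inE /=.
rewrite /qm (qmeet_okernel_lex _ _ (fun k => ltn_ord (j k))); congr (_ == _).
by apply: weak_order_inj => k l; rewrite !weak_order_qmeet !weak_order_okernel !hE.
Qed.

(** Expand C_1 as the sum of the idempotents C^(k): the k-th coefficient of the
   entry (pi, sigma) vanishes for k > |sigma|, that of (sigma, tau) for
   k < |sigma|, which leaves k = |sigma|. *)
Lemma mu_zeta_inverse pi tau :
  \sum_(sigma | osp_le sigma pi && osp_le tau sigma)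
     zeta_tilde K sigma pi * mu_tilde K tau sigma = (pi == tau)%:R.
Proof.
have size_OP sigma : (size sigma < n.+1)%N by rewrite ltnS size_bseq.
have size_card_poly : (size (card_poly pi tau) <= n.+1)%N.
  apply/leq_sizeP => k nk; rewrite coef_card_poly_top ?gtn_eqF //.
    exact: leq_trans nk.
  by rewrite ltnW // (leq_trans _ nk).
rewrite -card_poly1 (horner_coef_wide _ size_card_poly).
under [RHS]eq_bigr => k _.
  rewrite expr1n mulr1 (coef_semigroup charK (card_polyM pi tau)).
  over.
rewrite exchange_big [LHS]big_mkcond /=; apply: eq_bigr => sigma _.
rewrite (bigD1 (Ordinal (size_OP sigma))) //= big1 => [|k k_sigma].
  rewrite addr0 coef_card_poly_top // coef_card_poly_low // !eqxx.
  by do 2 case: osp_le; rewrite /= ?mul0r ?mulr0.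
rewrite -(inj_eq val_inj) /= in k_sigma.
have [ks|sk] := leqP k (size sigma).
  by rewrite (coef_card_poly_low _ ks) (negPf k_sigma) mulr0.
by rewrite (coef_card_poly_top _ (ltnW sk)) (negPf k_sigma) mul0r.
Qed.

End Incidence.

(** * Cumulants *)

Section Cumulants.
Variables (K : fieldType) (charK : [pchar K] =i pred0) (A B : assocAlgType K).
Variables (phi : {linear A -> B}) (S : spreadability_system phi) (n : nat).
Implicit Types (pi sigma tau : OP n) (X : 'I_n -> A).

Lemma phi_part_dotE pi X (N : 'I_(size pi) -> nat) :
  phi_part_dot S pi (fun k => N (block_index pi k)) X =
  \sum_(sigma | osp_le sigma pi)
    (\prod_(j < size pi) (bin_poly K (size (restr sigma (nth set0 pi j)))).[(N j)%:R]) *: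
      phi_part S sigma X.
Proof.
pose idx := {dffun forall k : 'I_n, 'I_(N (block_index pi k))}.
rewrite /phi_part_dot.
rewrite (partition_big (fun i : idx => qmeet pi (okernel (fun k => i k))) xpredT) //=.
rewrite [RHS]big_mkcond /=.
apply: eq_bigr => sigma _.
rewrite (eq_bigr (fun=> phi_part S sigma X)); last first.
  by move=> i /eqP <-.
rewrite sumr_const -[X in _ *+ X]cardsE card_qmeet_okernel.
case: osp_le; last by rewrite mul0n.
rewrite mul1n -scaler_nat natr_prod; congr (_ *: _).
by apply: eq_bigr => j _; rewrite horner_bin_poly.
Qed.

Lemma cumulantE pi X : cumulant S pi X =
  \sum_(sigma | osp_le sigma pi) mu_tilde K sigma pi *: phi_part S sigma X.
Proof.
pose q (sigma : OP n) (j : 'I_(size pi)) : {poly K} :=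
  bin_poly K (size (restr sigma (nth set0 pi j))).
pose b sigma := if osp_le sigma pi then phi_part S sigma X else 0.
have dotE N : phi_part_dot S pi (fun k => N (block_index pi k)) X =
    \sum_sigma (\prod_j (q sigma j).[(N j)%:R]) *: b sigma.
  rewrite phi_part_dotE big_mkcond; apply: eq_bigr => sigma _.
  by rewrite /b; case: ifP => // _; rewrite scaler0.
have [c0 c0P] := poly_eval_prod q b.
have coefE c : phi_polynomial (pi := pi) S X c -> c [ffun=> 1%N] =
    \sum_(sigma | osp_le sigma pi) mu_tilde K sigma pi *: phi_part S sigma X.
  move=> cP.
  (* D exceeds all exponents of c, and also the degrees of the binomial
     polynomials, so that the weights apply to both expressions. *)
  pose D := maxn (\max_(a : finsupp c) \max_j (fsval a j).+1)
    (\max_s \max_j size (q s j)).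
  have [lam lamP] := linear_coef_weights charK D.
  rewrite -(poly_eval_linear_coef lamP) => [|a j ac]; last first.
    apply: leq_trans (leq_maxl _ _).
    apply: leq_trans (leq_bigmax [` ac]%fset).
    exact: (leq_bigmax j).
  have evalE N : (forall j, (0 < N j)%N) -> poly_eval c N =
      \sum_sigma (\prod_j (q sigma j).[(N j)%:R]) *: b sigma.
    by move=> N0; rewrite -cP // dotE.
  under eq_bigr do rewrite evalE // scaler_sumr.
  rewrite exchange_big [RHS]big_mkcond /=; apply: eq_bigr => sigma _.
  under eq_bigr do rewrite scalerA -big_split /=.
  rewrite -scaler_suml -(bigA_distr_bigA (fun j t => lam t * (q sigma j).[t.+1%:R])) /=.
  under eq_bigr => j _.
    rewrite lamP; last first.
      apply: leq_trans (leq_maxr _ _).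
      by apply: leq_trans (leq_bigmax sigma); apply: (leq_bigmax j).
    over.
  rewrite /b; case: ifP => [sigma_pi|_]; last by rewrite scaler0.
  congr (_ *: _); have := coef_card_poly_low charK sigma (leqnn (size pi)).
  rewrite eqxx sigma_pi => <-; rewrite /card_poly sigma_pi.
  rewrite (coef_prod_bin_poly_low charK) ?eqxx //; exact: size_restr_gt0.
have c0X : phi_polynomial (pi := pi) S X c0 by move=> N _; rewrite dotE c0P.
apply: classical_sets.xget_unique; first by exists c0; rewrite ?coefE.
by move=> _ [c cP ->]; apply: coefE.
Qed.

Lemma phi_part_cumulantE pi X : phi_part S pi X =
  \sum_(sigma | osp_le sigma pi) zeta_tilde K sigma pi *: cumulant S sigma X.
Proof.
under eq_bigr do rewrite cumulantE scaler_sumr.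
rewrite (exchange_big_dep xpredT) //=.
under eq_bigr => tau _.
  under eq_bigr do rewrite scalerA.
  rewrite -scaler_suml (mu_zeta_inverse charK).
  over.
rewrite (bigD1 pi) //= eqxx scale1r big1 ?addr0 // => tau tau_pi.
by rewrite eq_sym (negPf tau_pi) scale0r.
Qed.

End Cumulants.

Unset Implicit Arguments.

Theorem theorem3p11 (R : realType) (A B : assocAlgType (complex R))
    (phi : {linear A -> B}) (S : spreadability_system phi)
    (n : nat) (n_gt0 : (0 < n)%N) (pi : OP n) (X : 'I_n -> A) :
  cumulant S pi X =
    \sum_(sigma : OP n | osp_le sigma pi)
      mu_tilde (complex R) sigma pi *: phi_part S sigma X
  /\
  phi_part S pi X =
    \sum_(sigma : OP n | osp_le sigma pi)
      zeta_tilde (complex R) sigma pi *: cumulant S sigma X.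
Proof.
have charC : [pchar (complex R)] =i pred0 := Num.Theory.pchar_num (complex R).
by split; [apply: cumulantE | apply: phi_part_cumulantE].
Qed.
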